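(* Let $G$ be a finite group acting smoothly on a manifold $M$. Then the functor $\Pi\colon\mathsf{Exit}(M)\to\mathsf{Exit}(M/G)$ induced by the quotient map is a right fibration.
   Context: A functor $p\colon E\to B$ is a right fibration (also called a discrete fibration) if for each object $e\in E$ and each arrow $f\colon b\to p(e)$ in $B$ there exists a unique arrow $g\colon e'\to e$ in $E$ with $p(g)=f$. $I=[0,1]$. A poset $P$ carries the Alexandrov topology (open sets = upward closed sets). A stratification of a space $X$ is a continuous map $\mathcal{S}\colon X\to P$ to a poset. An exit path is a continuous $f\colon I\to X$ with $\mathcal{S}(f(s))\le\mathcal{S}(f(t))$ whenever $s\le t$. An exit path homotopy is a homotopy $\mathcal{H}\colon I\times I\to X$ rel endpoints such that each $\mathcal{H}|_{I\times\{s\}}$ is an exit path. The exit path category $\mathsf{Exit}(X)$ has the points of $X$ as objects; morphisms $x\to y$ are exit paths from $x$ to $y$ modulo exit path homotopy; composition is concatenation and identities are constant paths. For a finite group $G$, $P_G$ is the poset of conjugacy classes of subgroups of $G$, with $[H]\le[K]$ iff $H$ is conjugate to a subgroup of $K$. $M$ is stratified by $x\mapsto[G_x]\in P_G^{\mathrm{op}}$ ($G_x$ the stabilizer), and $M/G$ (quotient topology) is stratified by $[x]\mapsto[G_x]\in P_G^{\mathrm{op}}$. With $\pi\colon M\to M/G$ the quotient map, $\Pi$ sends $x\mapsto[x]$ and $[f]\mapsto[\pi\circ f]$. *)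

(* Defs.v *)
From HB Require Import structures.
From mathcomp Require Import all_boot all_order all_algebra all_fingroup.
From mathcomp Require Import generic_quotient.
From mathcomp Require Import all_classical all_reals all_analysis.
From mathcomp Require Import lra.

Set Implicit Arguments.
Unset Strict Implicit.
Unset Printing Implicit Defensive.

Import Order.TTheory GRing.Theory Num.Theory.
Import numFieldNormedType.Exports.

Local Open Scope classical_set_scope.
Local Open Scope ring_scope.
Local Open Scope quotient_scope.

(* Composition is in diagrammatic order, to match concatenation of paths. *)
Record category := Category {
  obj :> Type;
  hom : obj -> obj -> Type;
  idm : forall a, hom a a;
  seqm : forall a b c, hom a b -> hom b c -> hom a c;
  seqm_idl : forall a b (f : hom a b), seqm (idm a) f = f;
  seqm_idr : forall a b (f : hom a b), seqm f (idm b) = f;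
  seqmA : forall a b c d (f : hom a b) (g : hom b c) (h : hom c d),
    seqm f (seqm g h) = seqm (seqm f g) h }.

Record functor (E B : category) := Functor {
  fobj :> E -> B;
  fmap : forall a b : E, hom a b -> hom (fobj a) (fobj b);
  fmap_id : forall a, fmap (idm a) = idm (fobj a);
  fmap_seqm : forall a b c (f : hom a b) (g : hom b c),
    fmap (seqm f g) = seqm (fmap f) (fmap g) }.

(* The lift is the pair of its source e' and the arrow e' -> e; the equation
   p(g) = f, between arrows into p(e) whose sources are only propositionally
   equal, is an equality of dependent pairs (source, arrow). *)
Definition right_fibration (E B : category) (p : functor E B) : Prop :=
  forall (e : E) (b : B) (f : hom b (p e)),
    exists! g : {e' : E & hom e' e},
      Tagged (fun b' : B => hom b' (p e)) (fmap p (tagged g))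
      = Tagged (fun b' : B => hom b' (p e)) f.

Definition alexandrov (d : Order.disp_t) (P : porderType d) : Type := P.

Section alexandrov_topology.
Context (d : Order.disp_t) (P : porderType d).

HB.instance Definition _ := Order.POrder.on (alexandrov P).

Definition up_closed (U : set (alexandrov P)) : Prop :=
  forall p q : P, (p <= q)%O -> U p -> U q.

Fact up_closedT : up_closed setT. Proof. by []. Qed.

Fact up_closedI (U V : set (alexandrov P)) :
  up_closed U -> up_closed V -> up_closed (U `&` V).
Proof. by move=> hU hV p q pq [/(hU _ _ pq) ? /(hV _ _ pq)]. Qed.

Fact up_closed_bigcup (I : Type) (F : I -> set (alexandrov P)) :
  (forall i, up_closed (F i)) -> up_closed (\bigcup_i F i).
Proof. by move=> hF p q pq [i _ /(hF i _ _ pq)]; exists i. Qed.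

HB.instance Definition _ := @isOpenTopological.Build (alexandrov P)
  up_closed up_closedT up_closedI up_closed_bigcup.

End alexandrov_topology.

Record stratification (X : topologicalType) (d : Order.disp_t)
    (P : porderType d) := Stratification {
  stratum :> X -> alexandrov P;
  stratum_continuous : continuous stratum }.

Lemma within_continuous_comp (X Y Z : topologicalType) (A : set X) (B : set Y)
    (f : X -> Y) (g : Y -> Z) :
  {within A, continuous f} -> {within B, continuous g} ->
  (forall x, A x -> B (f x)) -> {within A, continuous (g \o f)}.
Proof.
move=> /subspace_continuousP cf /subspace_continuousP cg AB.
apply/subspace_continuousP => x Ax U /= /(cg _ (AB _ Ax)).
rewrite /nbhs /= /within /= => /(cf _ Ax); rewrite /nbhs /= /within /=.
by apply: filterS => z h Az; apply: h => //; exact: AB.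
Qed.

Lemma pair_continuous (X Y Z : topologicalType) (f : X -> Y) (g : X -> Z) :
  continuous f -> continuous g -> continuous (fun x => (f x, g x)).
Proof. by move=> cf cg x; apply: cvg_pair; [exact: cf|exact: cg]. Qed.

Lemma within_continuous_eq (X Y : topologicalType) (A : set X) (f g : X -> Y) :
  (forall x, A x -> f x = g x) ->
  {within A, continuous f} -> {within A, continuous g}.
Proof.
move=> fg; apply: subspace_eq_continuous => x; rewrite inE => Ax.
exact: fg.
Qed.

Lemma within_continuous_paste (R : realType) (X Y : topologicalType)
    (A : set X) (k : X -> R) (a : R) (f g h : X -> Y) :
    closed A -> continuous k ->
    {within A `&` [set x | k x <= a], continuous f} ->
    {within A `&` [set x | a <= k x], continuous g} ->
    (forall x, A x -> k x <= a -> h x = f x) ->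
    (forall x, A x -> a <= k x -> h x = g x) ->
  {within A, continuous h}.
Proof.
move=> cA ck cf cg hf hg.
have -> : A = (A `&` [set x | k x <= a]) `|` (A `&` [set x | a <= k x]).
  by rewrite -setIUr; apply/seteqP; split=> [x Ax|x []//]; split=> //=;
     case: (leP (k x) a) => [|/ltW]; [left|right].
apply: withinU_continuous.
- apply: closedI => //; apply: (@preimage_closed _ _ k [set t | t <= a]).
    by move=> ? _; exact: ck.
  exact: closed_le.
- apply: closedI => //; apply: (@preimage_closed _ _ k [set t | a <= t]).
    by move=> ? _; exact: ck.
  exact: closed_ge.
- by apply: within_continuous_eq cf => x [Ax kx]; rewrite hf.
- by apply: within_continuous_eq cg => x [Ax kx]; rewrite hg.
Qed.

Local Notation I01 := (`[0, 1]%classic).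

Section exit_path.
Context (R : realType) (X : topologicalType) (d : Order.disp_t)
  (P : porderType d) (S : stratification X P).

(* A path I -> X is represented by a function on R of which only the
   restriction to [0, 1] matters: the junk values outside [0, 1] are forgotten
   by exit path homotopy, hence do not affect the arrows of Exit(X). *)
Definition is_exit_path (x y : X) (f : R -> X) : Prop :=
  [/\ {within I01, continuous f},
      forall s t : R, 0 <= s -> s <= t -> t <= 1 -> ((S (f s) : P) <= S (f t))%O,
      f 0 = x
    & f 1 = y].

Record exit_path (x y : X) := ExitPath {
  path_fun :> R -> X;
  path_funP : is_exit_path x y path_fun }.

HB.instance Definition _ x y := gen_eqMixin (exit_path x y).
HB.instance Definition _ x y := gen_choiceMixin (exit_path x y).

(* In H (t, s), t is the path parameter and s the homotopy parameter. *)
Definition exit_homotopic (x y : X) (f g : exit_path x y) : Prop :=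
  exists H : R * R -> X,
    [/\ {within I01 `*` I01, continuous H},
        forall s : R, I01 s -> is_exit_path x y (fun t => H (t, s)),
        forall t : R, I01 t -> H (t, 0) = f t
      & forall t : R, I01 t -> H (t, 1) = g t].

Lemma exit_homotopic_comp x y (f g : exit_path x y) (h : exit_path x y)
    (phi psi : R -> R) :
    continuous phi -> continuous psi ->
    (forall s t, 0 <= s -> s <= t -> t <= 1 -> phi s <= phi t) ->
    (forall s t, 0 <= s -> s <= t -> t <= 1 -> psi s <= psi t) ->
    phi 0 = 0 -> phi 1 = 1 -> psi 0 = 0 -> psi 1 = 1 ->
    (forall t : R, I01 t -> f t = h (phi t)) ->
    (forall t : R, I01 t -> g t = h (psi t)) ->
  exit_homotopic f g.
Proof.
move=> cphi cpsi mphi mpsi phi0 phi1 psi0 psi1 fE gE.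
have [ch mh h0 h1] := path_funP h.
pose K (z : R * R) : R := (1 - z.2) * phi z.1 + z.2 * psi z.1.
have phiI t : 0 <= t -> t <= 1 -> 0 <= phi t /\ phi t <= 1.
  by move=> t0 t1; split; [rewrite -phi0|rewrite -phi1]; apply: mphi.
have psiI t : 0 <= t -> t <= 1 -> 0 <= psi t /\ psi t <= 1.
  by move=> t0 t1; split; [rewrite -psi0|rewrite -psi1]; apply: mpsi.
have KI t s : 0 <= t -> t <= 1 -> 0 <= s -> s <= 1 -> 0 <= K (t, s) /\ K (t, s) <= 1.
  move=> t0 t1 s0 s1; have [? ?] := phiI _ t0 t1; have [? ?] := psiI _ t0 t1.
  by rewrite /K /=; split; nra.
have cK : continuous K.
  move=> z; apply: cvgD; apply: cvgM.
  - by apply: cvgB; [exact: cvg_cst|exact: cvg_snd].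
  - by apply: (@cvg_comp _ _ _ fst phi); [exact: cvg_fst|exact: cphi].
  - exact: cvg_snd.
  - by apply: (@cvg_comp _ _ _ fst psi); [exact: cvg_fst|exact: cpsi].
have chK : {within I01 `*` I01, continuous (h \o K)}.
  apply: (within_continuous_comp _ ch); first exact: continuous_subspaceT cK.
  by move=> [t s] /= []; rewrite !in_itv /= => /andP[? ?] /andP[? ?]; apply/andP/KI.
exists (h \o K); split => //.
- move=> s; rewrite /= in_itv /= => /andP[s0 s1]; split => /=.
  + apply: (within_continuous_comp (f := fun t => (t, s)) _ chK).
      apply/continuous_subspaceT/pair_continuous; first by move=> t; exact: cvg_id.
      by move=> t; exact: cvg_cst.
    by move=> t /= ?; split => //; rewrite in_itv /= s0.
  + move=> u v u0 uv v1; apply: mh.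
    * by apply KI => //; lra.
    * have := mphi _ _ u0 uv v1; have := mpsi _ _ u0 uv v1; rewrite /K /= => ? ?.
      by nra.
    * by apply KI => //; lra.
  + by rewrite /K /= phi0 psi0 !mulr0 addr0.
  + by rewrite /K /= phi1 psi1 !mulr1 subrK.
- by move=> t tI; rewrite /= /K /= subr0 mul1r mul0r addr0 fE.
- by move=> t tI; rewrite /= /K /= subrr mul1r mul0r add0r gE.
Qed.

Lemma exit_homotopic_eq x y (f g : exit_path x y) :
  (forall t : R, I01 t -> f t = g t) -> exit_homotopic f g.
Proof.
by move=> fg; apply: (@exit_homotopic_comp _ _ _ _ g id id) => // ?; exact: cvg_id.
Qed.

Lemma exit_homotopic_refl x y (f : exit_path x y) : exit_homotopic f f.
Proof. exact: exit_homotopic_eq. Qed.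

Lemma exit_homotopic_sym x y (f g : exit_path x y) :
  exit_homotopic f g -> exit_homotopic g f.
Proof.
move=> [H [cH eH H0 H1]].
have rI (s : R) : I01 s -> I01 (1 - s).
  by rewrite /= !in_itv /= => /andP[? ?]; apply/andP; split; lra.
exists (H \o (fun z => (z.1, 1 - z.2))); split.
- apply: (within_continuous_comp _ cH).
    apply/continuous_subspaceT/pair_continuous => z; first exact: cvg_fst.
    by apply: cvgB; [exact: cvg_cst|exact: cvg_snd].
  by move=> [t s] /= [? ?]; split => //=; exact: rI.
- by move=> s /rI /eH.
- by move=> t ?; rewrite /= subr0 H1.
- by move=> t ?; rewrite /= subrr H0.
Qed.

Lemma closed_I01 : closed (I01 : set R).
Proof. exact: interval_closed. Qed.

#[local] Hint Resolve closed_I01 : core.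

Lemma closed_square : closed (I01 `*` I01 : set (R * R)).
Proof.
rewrite (_ : _ `*` _ = fst @^-1` I01 `&` snd @^-1` I01) //.
by apply: closedI; apply: preimage_closed => // z _; [exact: cvg_fst|exact: cvg_snd].
Qed.

#[local] Hint Resolve closed_square : core.

Lemma exit_homotopic_trans x y (f g h : exit_path x y) :
  exit_homotopic f g -> exit_homotopic g h -> exit_homotopic f h.
Proof.
move=> [H [cH eH H0 H1]] [K [cK eK K0 K1]].
pose L (z : R * R) : X :=
  if z.2 <= 2^-1 then H (z.1, 2 * z.2) else K (z.1, 2 * z.2 - 1).
have lI (s : R) : I01 s -> s <= 2^-1 -> I01 (2 * s).
  by rewrite /= !in_itv /= => /andP[? ?] ?; apply/andP; split; lra.
have rI (s : R) : I01 s -> 2^-1 <= s -> I01 (2 * s - 1).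
  by rewrite /= !in_itv /= => /andP[? ?] ?; apply/andP; split; lra.
have Ll (t s : R) : s <= 2^-1 -> L (t, s) = H (t, 2 * s) by rewrite /L /= => ->.
have Lr (t s : R) : I01 t -> 2^-1 <= s -> L (t, s) = K (t, 2 * s - 1).
  move=> tI; rewrite /L /= le_eqVlt => /orP[/eqP <-|]; last by rewrite ltNge => /negbTE ->.
  by rewrite lexx divff ?pnatr_eq0// subrr H1 ?K0.
exists L; split.
- apply: (@within_continuous_paste _ _ _ _ snd 2^-1
    (H \o (fun z => (z.1, 2 * z.2))) (K \o (fun z => (z.1, 2 * z.2 - 1)))) => //.
  + by move=> ?; exact: cvg_snd.
  + apply: (within_continuous_comp _ cH).
      apply/continuous_subspaceT/pair_continuous => z; first exact: cvg_fst.
      by apply: cvgM; [exact: cvg_cst|exact: cvg_snd].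
    by move=> [t s] [] /= [? ?] ?; split => //; exact: lI.
  + apply: (within_continuous_comp _ cK).
      apply/continuous_subspaceT/pair_continuous => z; first exact: cvg_fst.
      by apply: cvgB; [apply: cvgM; [exact: cvg_cst|exact: cvg_snd]|exact: cvg_cst].
    by move=> [t s] [] /= [? ?] ?; split => //; exact: rI.
  + by move=> [t s] _ /= /Ll.
  + by move=> [t s] [/= tI _] /= /(Lr _ _ tI).
- move=> s sI; case: (leP s 2^-1) => hs.
    rewrite (_ : (fun t => _) = (fun t => H (t, 2 * s))); first exact/eH/lI.
    by apply/funext => t; exact: Ll.
  rewrite (_ : (fun t => _) = (fun t => K (t, 2 * s - 1))); first exact/eK/rI/ltW.
  by apply/funext => t; rewrite /L /= leNgt hs.
- by move=> t tI; rewrite Ll ?mulr0 ?H0 ?invr_ge0.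
- move=> t tI; rewrite Lr //; last by lra.
  by rewrite (_ : 2 * 1 - 1 = 1 :> R) ?K1 //; lra.
Qed.

Definition concat (T : Type) (f g : R -> T) (t : R) : T :=
  if t <= 2^-1 then f (2 * t) else g (2 * t - 1).

Lemma concatl (T : Type) (f g : R -> T) t : t <= 2^-1 -> concat f g t = f (2 * t).
Proof. by rewrite /concat => ->. Qed.

Lemma concatr (T : Type) (f g : R -> T) t :
  f 1 = g 0 -> 2^-1 <= t -> concat f g t = g (2 * t - 1).
Proof.
move=> fg; rewrite /concat le_eqVlt => /orP[/eqP <-|].
  by rewrite lexx divff ?pnatr_eq0// subrr.
by rewrite ltNge => /negbTE ->.
Qed.

Lemma concat_is_exit_path x y z (f g : R -> X) :
  is_exit_path x y f -> is_exit_path y z g -> is_exit_path x z (concat f g).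
Proof.
move=> [cf mf f0 f1] [cg mg g0 g1]; have fg : f 1 = g 0 by rewrite f1 g0.
split.
- apply: (@within_continuous_paste _ _ _ _ id 2^-1
    (f \o (fun t => 2 * t)) (g \o (fun t => 2 * t - 1))) => //.
  + by move=> ?; exact: cvg_id.
  + apply: (within_continuous_comp _ cf).
      apply: continuous_subspaceT => t.
      by apply: cvgM; [exact: cvg_cst|exact: cvg_id].
    by move=> t /= []; rewrite !in_itv /= => /andP[? ?] ?; apply/andP; split; lra.
  + apply: (within_continuous_comp _ cg).
      apply: continuous_subspaceT => t.
      by apply: cvgB; [apply: cvgM; [exact: cvg_cst|exact: cvg_id]|exact: cvg_cst].
    by move=> t /= []; rewrite !in_itv /= => /andP[? ?] ?; apply/andP; split; lra.
  + by move=> t _ /concatl ->.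
  + by move=> t _ /(concatr fg) ->.
- move=> s t s0 st t1.
  case: (leP t 2^-1) => ht.
    by rewrite !concatl //; [apply: mf; lra|lra].
  case: (leP s 2^-1) => hs.
    rewrite concatl // (concatr fg (ltW ht)).
    apply: (@le_trans _ _ (S y : P)).
      by rewrite -f1; apply: mf; lra.
    by rewrite -g0; apply: mg; lra.
  by rewrite (concatr fg (ltW ht)) (concatr fg (ltW hs)); apply: mg; lra.
- by rewrite concatl ?mulr0 ?invr_ge0.
- rewrite concatr //; last by lra.
  by rewrite (_ : 2 * 1 - 1 = 1 :> R) ?g1 //; lra.
Qed.

Definition exit_concat x y z (f : exit_path x y) (g : exit_path y z) :
    exit_path x z :=
  ExitPath (concat_is_exit_path (path_funP f) (path_funP g)).

Lemma cst_is_exit_path x : is_exit_path x x (cst x).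
Proof. by split => //; apply: continuous_subspaceT => ?; exact: cvg_cst. Qed.

Definition exit_cst x : exit_path x x := ExitPath (cst_is_exit_path x).

Lemma exit_concat_homotopic x y z (f f' : exit_path x y) (g g' : exit_path y z) :
  exit_homotopic f f' -> exit_homotopic g g' ->
  exit_homotopic (exit_concat f g) (exit_concat f' g').
Proof.
move=> [H [cH eH H0 H1]] [K [cK eK K0 K1]].
have lI (s : R) : I01 s -> s <= 2^-1 -> I01 (2 * s).
  by rewrite /= !in_itv /= => /andP[? ?] ?; apply/andP; split; lra.
have rI (s : R) : I01 s -> 2^-1 <= s -> I01 (2 * s - 1).
  by rewrite /= !in_itv /= => /andP[? ?] ?; apply/andP; split; lra.
pose L (w : R * R) := concat (fun t => H (t, w.2)) (fun t => K (t, w.2)) w.1.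
have HK (s : R) : I01 s -> H (1, s) = K (0, s).
  by move=> sI; have [_ _ _ ->] := eH _ sI; have [_ _ -> _] := eK _ sI.
exists L; split.
- apply: (@within_continuous_paste _ _ _ _ fst 2^-1
    (H \o (fun z => (2 * z.1, z.2))) (K \o (fun z => (2 * z.1 - 1, z.2)))) => //.
  + by move=> ?; exact: cvg_fst.
  + apply: (within_continuous_comp _ cH).
      apply/continuous_subspaceT/pair_continuous => w; last exact: cvg_snd.
      by apply: cvgM; [exact: cvg_cst|exact: cvg_fst].
    by move=> [t s] [] /= [? ?] ?; split => //; exact: lI.
  + apply: (within_continuous_comp _ cK).
      apply/continuous_subspaceT/pair_continuous => w; last exact: cvg_snd.
      by apply: cvgB; [apply: cvgM; [exact: cvg_cst|exact: cvg_fst]|exact: cvg_cst].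
    by move=> [t s] [] /= [? ?] ?; split => //; exact: rI.
  + by move=> [t s] _ /= ht; rewrite /L /= concatl.
  + by move=> [t s] [/= _ sI] /= ht; rewrite /L /= concatr //; exact: HK.
- by move=> s sI; exact: concat_is_exit_path (eH _ sI) (eK _ sI).
- move=> t tI; rewrite /L /= /concat; case: (leP t 2^-1) => ht.
    by rewrite H0 //; exact: lI.
  by rewrite K0 //; exact/rI/ltW.
- move=> t tI; rewrite /L /= /concat; case: (leP t 2^-1) => ht.
    by rewrite H1 //; exact: lI.
  by rewrite K1 //; exact/rI/ltW.
Qed.

Definition exit_homotopicb x y : rel (exit_path x y) :=
  fun f g => `[< exit_homotopic f g >].

Lemma exit_homotopicb_refl x y : reflexive (@exit_homotopicb x y).
Proof. by move=> f; apply/asboolP/exit_homotopic_refl. Qed.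

Lemma exit_homotopicb_sym x y : symmetric (@exit_homotopicb x y).
Proof. by move=> f g; apply/asboolP/asboolP; exact: exit_homotopic_sym. Qed.

Lemma exit_homotopicb_trans x y : transitive (@exit_homotopicb x y).
Proof.
move=> g f h /asboolP fg /asboolP gh; apply/asboolP.
exact: exit_homotopic_trans gh.
Qed.

Definition exit_homotopy_equiv x y : equiv_rel (exit_path x y) :=
  EquivRel (@exit_homotopicb x y) (@exit_homotopicb_refl x y)
    (@exit_homotopicb_sym x y) (@exit_homotopicb_trans x y).

Definition exit_hom x y : Type := {eq_quot (exit_homotopy_equiv x y)}.

Definition exit_class x y (f : exit_path x y) : exit_hom x y :=
  \pi_({eq_quot (exit_homotopy_equiv x y)}) f.

Definition exit_repr x y (f : exit_hom x y) : exit_path x y :=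
  repr (f : {eq_quot (exit_homotopy_equiv x y)}).

Lemma exit_reprK x y (f : exit_hom x y) : exit_class (exit_repr f) = f.
Proof. exact: reprK. Qed.

Lemma exit_classP x y (f g : exit_path x y) :
  exit_class f = exit_class g <-> exit_homotopic f g.
Proof. by split => [/eqmodP/asboolP|?]; last exact/eqmodP/asboolP. Qed.

Definition exit_id x : exit_hom x x := exit_class (exit_cst x).

Definition exit_comp x y z (f : exit_hom x y) (g : exit_hom y z) : exit_hom x z :=
  exit_class (exit_concat (exit_repr f) (exit_repr g)).

Lemma exit_compE x y z (f : exit_path x y) (g : exit_path y z) :
  exit_comp (exit_class f) (exit_class g) = exit_class (exit_concat f g).
Proof.
by apply/exit_classP/exit_concat_homotopic; apply/exit_classP; exact: exit_reprK.
Qed.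

Lemma continuous_fun_min (f g : R -> R) :
  continuous f -> continuous g -> continuous (fun t => Num.min (f t) (g t)).
Proof. by move=> cf cg t; apply: continuous_min; [exact: cf|exact: cg]. Qed.

Lemma continuous_fun_max (f g : R -> R) :
  continuous f -> continuous g -> continuous (fun t => Num.max (f t) (g t)).
Proof. by move=> cf cg t; apply: continuous_max; [exact: cf|exact: cg]. Qed.

Lemma affine_continuous (a b : R) : continuous (fun t => a * t + b).
Proof.
by move=> t; apply: cvgD; [apply: cvgM; [exact: cvg_cst|exact: cvg_id]|exact: cvg_cst].
Qed.

Lemma exit_comp_idl x y (f : exit_hom x y) : exit_comp (exit_id x) f = f.
Proof.
rewrite -(exit_reprK f) /exit_id exit_compE; apply/exit_classP.
move: (exit_repr f) => {}f; have [_ _ f0 _] := path_funP f.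
apply: (@exit_homotopic_comp _ _ _ _ f (fun t => Num.max (0 * t + 0) (2 * t + -1)) id) => //.
- by apply: continuous_fun_max; exact: affine_continuous.
- by move=> ?; exact: cvg_id.
- by move=> s t s0 st t1; apply: le_max2; lra.
- by case: leP => ?; lra.
- by case: leP => ?; lra.
- move=> t tI /=; case: leP => ht.
    by rewrite concatr //=; lra.
  by rewrite concatl /cst ?mul0r ?addr0 ?f0//; lra.
Qed.

Lemma exit_comp_idr x y (f : exit_hom x y) : exit_comp f (exit_id y) = f.
Proof.
rewrite -(exit_reprK f) /exit_id exit_compE; apply/exit_classP.
move: (exit_repr f) => {}f; have [_ _ _ f1] := path_funP f.
apply: (@exit_homotopic_comp _ _ _ _ f (fun t => Num.min (2 * t + 0) (0 * t + 1)) id) => //.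
- by apply: continuous_fun_min; exact: affine_continuous.
- by move=> ?; exact: cvg_id.
- by move=> s t s0 st t1; apply: le_min2; lra.
- by case: leP => ?; lra.
- by case: leP => ?; lra.
- move=> t tI /=; case: leP => ht.
    by rewrite concatl //=; [rewrite addr0|lra].
  by rewrite concatr /cst ?mul0r ?add0r ?f1//; lra.
Qed.

Lemma exit_compA x y z w (f : exit_hom x y) (g : exit_hom y z) (h : exit_hom z w) :
  exit_comp f (exit_comp g h) = exit_comp (exit_comp f g) h.
Proof.
rewrite -(exit_reprK f) -(exit_reprK g) -(exit_reprK h) !exit_compE.
apply/exit_classP/exit_homotopic_sym.
move: (exit_repr f) (exit_repr g) (exit_repr h) => {}f {}g {}h.
have [_ _ _ f1] := path_funP f; have [_ _ g0 g1] := path_funP g.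
have [_ _ h0 _] := path_funP h.
apply: (@exit_homotopic_comp _ _ _ _ (exit_concat f (exit_concat g h))
  (fun t => Num.min (2 * t + 0) (Num.min (1 * t + 4^-1) (2^-1 * t + 2^-1))) id) => //.
- by do 2 (apply: continuous_fun_min; first exact: affine_continuous);
    exact: affine_continuous.
- by move=> ?; exact: cvg_id.
- by move=> s t s0 st t1; do 2 (apply: le_min2; first by lra); lra.
- by rewrite !min_l ?le_min; lra.
- by rewrite [X in Num.min _ X]min_r ?min_r; lra.
- have gh : g 1 = h 0 by rewrite g1 h0.
  have fgh : f 1 = concat g h 0 by rewrite concatl ?mulr0 ?f1 ?g0 ?invr_ge0.
  have fg : concat f g 1 = h 0.
    rewrite concatr ?f1 ?g0 //; last by lra.
    by rewrite (_ : 2 * 1 - 1 = 1 :> R) ?gh //; lra.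
  move=> t tI /=; case: (leP t 4^-1) => t4.
    rewrite min_l; last by rewrite le_min; apply/andP; split; lra.
    rewrite concatl; last by lra.
    rewrite concatl; last by lra.
    by rewrite concatl; [rewrite addr0|lra].
  case: (leP t 2^-1) => t2.
    rewrite min_r; last by rewrite ge_min; apply/orP; left; lra.
    rewrite min_l; last by lra.
    rewrite concatl // concatr ?f1 ?g0 //; last by lra.
    rewrite (concatr fgh); last by lra.
    by rewrite concatl; [congr (path_fun g _); lra|lra].
  rewrite min_r; last by rewrite ge_min; apply/orP; left; lra.
  rewrite min_r; last by lra.
  rewrite (concatr fg); last by lra.
  rewrite (concatr fgh); last by lra.
  by rewrite (concatr gh); [congr (path_fun h _); lra|lra].
Qed.

Definition Exit : category :=
  Category exit_comp_idl exit_comp_idr exit_compA.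

End exit_path.

Section exit_functor.
Context (R : realType) (X Y : topologicalType) (d : Order.disp_t)
  (P : porderType d) (S : stratification X P) (T : stratification Y P)
  (h : X -> Y).
Hypotheses (ch : continuous h) (hE : forall x, T (h x) = S x).

Lemma comp_is_exit_path x y (f : R -> X) :
  is_exit_path S x y f -> is_exit_path T (h x) (h y) (h \o f).
Proof.
move=> [cf mf f0 f1]; split => /=.
- by apply: (within_continuous_comp cf (B := setT)) => //; exact: continuous_subspaceT.
- by move=> s t s0 st t1; rewrite !hE; exact: mf.
- by rewrite f0.
- by rewrite f1.
Qed.

Definition map_path x y (f : exit_path R S x y) : exit_path R T (h x) (h y) :=
  ExitPath (comp_is_exit_path (path_funP f)).

Lemma map_path_homotopic x y (f g : exit_path R S x y) :
  exit_homotopic f g -> exit_homotopic (map_path f) (map_path g).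
Proof.
move=> [H [cH eH H0 H1]]; exists (h \o H); split.
- by apply: (within_continuous_comp cH (B := setT)) => //; exact: continuous_subspaceT.
- by move=> s /eH /comp_is_exit_path.
- by move=> t /H0 /= ->.
- by move=> t /H1 /= ->.
Qed.

Definition map_exit x y (f : exit_hom R S x y) : exit_hom R T (h x) (h y) :=
  exit_class (map_path (exit_repr f)).

Lemma map_exitE x y (f : exit_path R S x y) :
  map_exit (exit_class f) = exit_class (map_path f).
Proof.
by apply/exit_classP/map_path_homotopic/exit_classP; exact: exit_reprK.
Qed.

Lemma map_exit_id x : map_exit (exit_id R S x) = exit_id R T (h x).
Proof. by rewrite map_exitE; apply/exit_classP/exit_homotopic_eq. Qed.

Lemma map_exit_comp x y z (f : exit_hom R S x y) (g : exit_hom R S y z) :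
  map_exit (exit_comp f g) = exit_comp (map_exit f) (map_exit g).
Proof.
rewrite -(exit_reprK f) -(exit_reprK g) exit_compE !map_exitE exit_compE.
apply/exit_classP/exit_homotopic_eq => t _.
by rewrite /= /concat; case: ifP.
Qed.

Definition Exit_functor : functor (Exit R S) (Exit R T) :=
  @Functor (Exit R S) (Exit R T) h map_exit map_exit_id map_exit_comp.

End exit_functor.

Section subgroup_class.
Context (gT : finGroupType).

Definition is_subgroup_class (C : {set {set gT}}) : bool :=
  [exists H : {group gT}, C == (H :^: [set: gT]%SET)%g].

Record subgroup_class := SubgroupClass {
  class_members : {set {set gT}};
  class_membersP : is_subgroup_class class_members }.

HB.instance Definition _ := [isSub for class_members].
HB.instance Definition _ := [Finite of subgroup_class by <:].

Fact conj_class_proof (H : {group gT}) :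
  is_subgroup_class (H :^: [set: gT]%SET)%g.
Proof. by apply/existsP; exists H. Qed.

Definition conj_class (H : {group gT}) : subgroup_class :=
  SubgroupClass (conj_class_proof H).

Lemma conj_classP (C : subgroup_class) : exists H, C = conj_class H.
Proof.
by case: C => C CP; have /existsP[H /eqP CE] := CP; exists H; exact: val_inj.
Qed.

(* A pair of members A \subset B exists iff H is conjugate to a subgroup of K,
   where C = [H] and D = [K]: see subgroup_class_leP. *)
Definition subgroup_class_le (C D : subgroup_class) : bool :=
  [exists H in class_members C, exists K in class_members D, H \subset K].

Lemma subgroup_class_leP (H K : {group gT}) :
  reflect (exists x, (H :^ x)%g \subset K)
    (subgroup_class_le (conj_class H) (conj_class K)).
Proof.
apply: (iffP exists_inP) => [[_ /imsetP[x _ ->] /exists_inP[_ /imsetP[y _ ->]]]|].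
  by rewrite -sub_conjgV -conjsgM => ?; exists (x * y^-1)%g.
move=> [x HxK]; exists (H :^ x)%g; first exact: imset_f.
apply/exists_inP; exists (K : {set gT}) => //.
by apply/imsetP; exists 1%g; rewrite ?inE ?conjsg1.
Qed.

Lemma conj_class_eq (H K : {group gT}) x :
  (H :^ x)%g = K -> conj_class H = conj_class K.
Proof.
move=> HK; apply: val_inj => /=; apply/setP => A.
apply/imsetP/imsetP => -[y _ ->].
- by exists (x^-1 * y)%g; rewrite ?inE // -HK -conjsgM mulKVg.
- by exists (x * y)%g; rewrite ?inE // -HK -conjsgM.
Qed.

Fact subgroup_class_le_refl : reflexive subgroup_class_le.
Proof.
move=> C; have [H ->] := conj_classP C.
by apply/subgroup_class_leP; exists 1%g; rewrite conjsg1.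
Qed.

Fact subgroup_class_le_anti : antisymmetric subgroup_class_le.
Proof.
move=> C D; have [H ->] := conj_classP C; have [K ->] := conj_classP D.
move=> /andP[/subgroup_class_leP[x Hx] /subgroup_class_leP[y Ky]].
apply: (@conj_class_eq _ _ x); apply/eqP; rewrite eqEcard Hx /= cardJg.
by rewrite -(cardJg K y) subset_leq_card.
Qed.

Fact subgroup_class_le_trans : transitive subgroup_class_le.
Proof.
move=> D C E; have [H ->] := conj_classP C; have [K ->] := conj_classP D.
have [L ->] := conj_classP E.
move=> /subgroup_class_leP[x Hx] /subgroup_class_leP[y Ky].
apply/subgroup_class_leP; exists (x * y)%g; rewrite conjsgM.
by apply: fintype.subset_trans Ky; rewrite conjSg.
Qed.

Fact subgroup_class_display : Order.disp_t.
Proof. exact: Order.Disp tt tt. Qed.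

HB.instance Definition _ := Order.Le_isPOrder.Build subgroup_class_display
  subgroup_class subgroup_class_le_refl subgroup_class_le_anti
  subgroup_class_le_trans.

End subgroup_class.

Section smooth.
Context (R : realType).

(* f is of class C^k on the open set U. In finite dimension, continuity of
   x |-> 'd f x is equivalent to that of x |-> 'd f x v for all v, whence the
   recursion on the directional derivatives. *)
Fixpoint differentiable_class (m n k : nat) (U : set 'rV[R]_m)
    (f : 'rV[R]_m -> 'rV[R]_n) : Prop :=
  match k with
  | 0 => forall x, U x -> {for x, continuous f}
  | k'.+1 => (forall x, U x -> differentiable f x) /\
             forall v, differentiable_class k' U (fun x => 'd f x v)
  end.

Definition smooth_on (m n : nat) (U : set 'rV[R]_m)
    (f : 'rV[R]_m -> 'rV[R]_n) : Prop :=
  forall k, differentiable_class k U f.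

(* chart_inv is only meaningful on the open image chart_map @` chart_dom. *)
Record chart (n : nat) (M : topologicalType) := Chart {
  chart_dom : set M;
  chart_map :> M -> 'rV[R]_n;
  chart_inv : 'rV[R]_n -> M;
  chart_dom_open : open chart_dom;
  chart_cod_open : open (chart_map @` chart_dom);
  chart_mapK : forall x, chart_dom x -> chart_inv (chart_map x) = x;
  chart_map_continuous : {within chart_dom, continuous chart_map};
  chart_inv_continuous :
    {within chart_map @` chart_dom, continuous chart_inv} }.

Record smooth_manifold (n : nat) := SmoothManifold {
  manifold_space :> topologicalType;
  manifold_hausdorff : hausdorff_space manifold_space;
  manifold_second_countable : @second_countable manifold_space;
  atlas : set (chart n manifold_space);
  atlas_cover : forall x, exists2 c, atlas c & chart_dom c x;
  atlas_smooth : forall c c', atlas c -> atlas c' ->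
    smooth_on (c @` (chart_dom c `&` chart_dom c')) (c' \o chart_inv c) }.

Definition smooth_map (m n : nat) (M : smooth_manifold m)
    (N : smooth_manifold n) (f : M -> N) : Prop :=
  continuous f /\
  forall (c : chart m M) (c' : chart n N), atlas c -> atlas c' ->
    smooth_on (c @` (chart_dom c `&` f @^-1` chart_dom c'))
      (c' \o f \o chart_inv c).

End smooth.

(* As always with {action gT &-> M}, the group acts on the right; x |-> to x g
   is the action of g^-1 in the corresponding left action, which has the same
   orbits and stabilizers. *)
Section smooth_action.
Context (R : realType) (n : nat) (M : smooth_manifold R n) (gT : finGroupType)
  (to : {action gT &-> M}).

Definition smooth_action : Prop := forall g : gT, smooth_map (to^~ g).

Lemma action_is_action : is_action [set: gT]%SET to. Proof. by case: to. Qed.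

Lemma actx_inj g : injective (to^~ g).
Proof. exact: action_is_action.1. Qed.

Lemma actxM x g h : to x (g * h)%g = to (to x g) h.
Proof. by apply: action_is_action.2; rewrite inE. Qed.

Lemma actx1 x : to x 1%g = x.
Proof. by apply: (@actx_inj 1%g); rewrite -actxM mulg1. Qed.

Definition stabilizer_set (x : M) : {set gT} := [set g | to x g == x]%SET.

Fact stabilizer_group_set x : group_set (stabilizer_set x).
Proof.
apply/group_setP; split => [|g h]; first by rewrite inE actx1.
by rewrite !inE actxM => /eqP -> /eqP ->.
Qed.

Definition stabilizer (x : M) : {group gT} := Group (stabilizer_group_set x).

Definition orbit_rel : rel M := fun x y => [exists g, to x g == y].

Fact orbit_rel_refl : reflexive orbit_rel.
Proof. by move=> x; apply/existsP; exists 1%g; rewrite actx1. Qed.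

Fact orbit_rel_sym : symmetric orbit_rel.
Proof.
move=> x y; apply/existsP/existsP => -[g /eqP <-]; exists g^-1%g;
  by rewrite -actxM mulgV actx1.
Qed.

Fact orbit_rel_trans : transitive orbit_rel.
Proof.
move=> y x z /existsP[g /eqP <-] /existsP[h /eqP <-]; apply/existsP.
by exists (g * h)%g; rewrite actxM.
Qed.

Definition orbit_equiv : equiv_rel M :=
  EquivRel orbit_rel orbit_rel_refl orbit_rel_sym orbit_rel_trans.

Definition orbit_space : topologicalType :=
  quotient_topology {eq_quot orbit_equiv}.

Definition orbit_map (x : M) : orbit_space :=
  \pi_(quotient_topology {eq_quot orbit_equiv}) x.

Lemma orbit_map_continuous : continuous orbit_map.
Proof. exact: pi_continuous. Qed.

Lemma orbit_mapP x y : orbit_map x = orbit_map y <-> exists g, to x g = y.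
Proof.
split=> [/eqmodP /existsP[g /eqP ?]|[g xy]]; first by exists g.
by apply/eqmodP/existsP; exists g; rewrite xy.
Qed.

(* _^d is the opposite poset. *)
Definition isotropy_type (x : M) : (subgroup_class gT)^d :=
  conj_class (stabilizer x).

Definition orbit_type (q : orbit_space) : (subgroup_class gT)^d :=
  isotropy_type (repr (q : quotient_topology {eq_quot orbit_equiv})).

Lemma isotropy_type_act x g : isotropy_type (to x g) = isotropy_type x.
Proof.
apply: (@conj_class_eq _ _ _ g^-1%g); apply/setP => h.
rewrite mem_conjgV !inE conjgE -actxM mulKVg actxM.
exact: (inj_eq (@actx_inj g)).
Qed.

Lemma orbit_typeE x : orbit_type (orbit_map x) = isotropy_type x.
Proof.
have /orbit_mapP[g gx] : orbit_map x
    = orbit_map (repr (orbit_map x : quotient_topology {eq_quot orbit_equiv})).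
  by rewrite /orbit_map reprK.
by rewrite /orbit_type -gx isotropy_type_act.
Qed.

Hypothesis smooth_to : smooth_action.

Lemma isotropy_type_continuous :
  continuous (isotropy_type : M -> alexandrov (subgroup_class gT)^d).
Proof.
have near_stab x : \forall y \near x, (stabilizer y \subset stabilizer x)%g.
  have H (g : gT) : \forall y \near x, to x g != x -> to y g != y.
    case: (eqVneq (to x g) x) => [_|gx]; first exact: nearW.
    have := @manifold_hausdorff _ _ M.
    rewrite open_hausdorff => /(_ _ _ gx)[[A B]] [/= /set_mem Agx /set_mem Bx].
    move=> [oA oB /eqP AB].
    have [cg _] := smooth_to g.
    have nA : \forall y \near x, A (to y g) by apply: cg; exact: open_nbhs_nbhs.
    have nB : \forall y \near x, B y by exact: open_nbhs_nbhs.
    near=> y => _; apply/eqP => gy.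
    suff : (A `&` B) y by rewrite AB.
    by split; [rewrite -gy; near: y|near: y].
  have : \forall y \near x, forall g, to x g != x -> to y g != y.
    exact: filter_forall.
  apply: filterS => y Hy; apply/fintype.subsetP => g; rewrite !inE.
  by apply: contraLR; exact: Hy.
apply/continuousP => U oU; rewrite openE => x /= Ux.
apply: filterS (near_stab x) => y yx; apply: (oU _ _ _ Ux).
rewrite leEdual; apply/subgroup_class_leP; exists 1%g.
by rewrite conjsg1.
Unshelve. all: by end_near.
Qed.

Lemma orbit_type_continuous :
  continuous (orbit_type : orbit_space -> alexandrov (subgroup_class gT)^d).
Proof.
apply/quotient_continuous; rewrite (_ : _ \o _ = isotropy_type).
  exact: isotropy_type_continuous.
by apply/funext => x; exact: orbit_typeE.
Qed.

Definition isotropy_stratification : stratification M (subgroup_class gT)^d :=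
  Stratification isotropy_type_continuous.

Definition orbit_stratification :
    stratification orbit_space (subgroup_class gT)^d :=
  Stratification orbit_type_continuous.

Definition quotient_functor : functor (Exit R isotropy_stratification)
                        (Exit R orbit_stratification) :=
  Exit_functor R (S := isotropy_stratification) (T := orbit_stratification)
    orbit_map_continuous orbit_typeE.

End smooth_action.

(* Main.v *)
Require Import Defs.
From mathcomp Require Import all_boot all_order all_algebra all_fingroup.
From mathcomp Require Import all_classical all_reals all_analysis.
From mathcomp Require Import generic_quotient lra.

Set Implicit Arguments.
Unset Strict Implicit.
Unset Printing Implicit Defensive.

Import Order.TTheory GRing.Theory Num.Theory.
Import numFieldNormedType.Exports.

Local Open Scope classical_set_scope.
Local Open Scope ring_scope.
Local Open Scope quotient_scope.

(** A morphism of Exit(M/G) with target the orbit of e lifts uniquely to a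
    morphism with target e because paths and homotopies are lifted backwards in
    time. Everything rests on two facts: the finite group acts by homeomorphisms,
    and M is Hausdorff. They give every point x a basis of open neighbourhoods U,
    called tubes, which are stable under the stabilizer of x
    and disjoint from their translates by the other group elements
    ([tube_basis]).

    Backwards in time along an exit path the isotropy type can only get larger,
    whereas the stabilizers of the points of a tube around x lie in that of x.
    So when the path, at time t, is at the orbit of x, then just before t it can
    be lifted to the tube only through points with exactly the stabilizer of x.
    Over such points the tube meets each orbit once: the lift to the tube exists,
    is unique and is continuous ([local_section]). This is the step to the left
    of t. At the other kind of step, where a lift is known on a half-open
    interval with left end t, the lift has a limit at t because its points, by
    connectedness, stay in a single translate of a tube ([lift_from_left_limit]).
    Induction on the reals, running down from the end of the path, combines the
    two steps: every exit path lifts ([exists_lift]).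

    Uniqueness of lifts and continuity of lifted homotopies are one and the same
    statement, [lift_near]: if a family of paths h y approaches a path x of M
    orbitwise, and approaches it at the final time, then it approaches it at all
    earlier times. For a family of one member and the trivial filter this is
    uniqueness ([unique_lift]). For the slices of a homotopy of exit paths,
    lifted one by one, and the neighbourhoods of a parameter, it is joint
    continuity of the lifted homotopy ([homotopy_lift]).

    Two lifts in Exit(M) of the same morphism project to exit homotopic paths. A
    homotopy between the projections lifts to a homotopy ending at e; its starting
    points trace a lift of a constant path, so they are constant. Hence the lifts
    have the same source and are exit homotopic ([quotient_lift_unique]). *)

(** * Real intervals and paths defined on the whole line *)

(** The infimum of the points above which P holds throughout would satisfy P by
    the second hypothesis, and could then be lowered by the third. *)
Lemma downward_real_induction (R : realType) (b : R) (P : R -> Prop) :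
    P b ->
    (forall t, t < b -> (forall s, t < s -> s <= b -> P s) -> P t) ->
    (forall t, t <= b -> P t ->
       exists2 e : R, 0 < e & forall s, t - e < s -> s < t -> P s) ->
  forall t, t <= b -> P t.
Proof.
move=> Pb Pclosed Popen a ab.
pose A := [set t | t <= b /\ forall s, t <= s -> s <= b -> P s].
have Ab : A b.
  by split => // s bs sb; have /eqP <- : b == s by rewrite eq_le bs sb.
apply: contrapT => nPa.
have lbA : lbound A a.
  move=> t [tb tP]; rewrite leNgt; apply/negP => ta; apply: nPa.
  by apply: tP => //; exact: ltW.
have hA : has_inf A by split; [exists b|exists a].
pose i := inf A.
have ib : i <= b by apply: ge_inf => //; exact: hA.2.
have Pgt s : i < s -> s <= b -> P s.
  move=> /(inf_lt hA.1) [t [tb tP] ts] sb; apply: tP => //; exact: ltW.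
have Pi : P i.
  have [ib'|ib'] := eqVneq i b; first by rewrite ib'.
  by apply: Pclosed => //; rewrite lt_neqAle ib' ib.
have [e e0 eP] := Popen _ ib Pi.
suff : A (i - e / 2) by move=> /(ge_inf hA.2); rewrite -/i; lra.
split=> [|s es sb]; first by lra.
have [si|si|->//] := ltgtP s i; last exact: Pgt.
by apply: eP => //; lra.
Qed.

Lemma nbhs_realP (R : realType) (t : R) (A : set R) :
  nbhs t A -> exists2 e : R, 0 < e & forall s, `|s - t| < e -> A s.
Proof.
move=> /nbhs_ballP[e /= e0 eA]; exists e => // s st.
by apply: eA; rewrite /ball /= distrC.
Qed.

Lemma continuous_near (R : realType) (X : topologicalType) (f : R -> X) t N :
    continuous f -> nbhs (f t) N ->
  exists2 e : R, 0 < e & forall s, `|s - t| < e -> N (f s).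
Proof. by move=> cf /cf /nbhs_realP. Qed.

Lemma maxr_continuous (R : realType) (a : R) : continuous (Num.max^~ a).
Proof. by move=> t; apply: continuous_max; [exact: cvg_id|exact: cvg_cst]. Qed.

Lemma minr_continuous (R : realType) (a : R) : continuous (Num.min^~ a).
Proof. by move=> t; apply: continuous_min; [exact: cvg_id|exact: cvg_cst]. Qed.

Lemma continuous_compT (X Y Z : topologicalType) (f : X -> Y) (g : Y -> Z) :
  continuous f -> continuous g -> continuous (g \o f).
Proof. by move=> cf cg t; apply: continuous_comp; [exact: cf|exact: cg]. Qed.

Lemma continuous_paste (R : realType) (X : topologicalType) (f g : R -> X) a :
  continuous f -> continuous g -> f a = g a ->
  continuous (fun t => if t <= a then f t else g t).
Proof.
move=> cf cg fg; apply/continuous_subspace_setT.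
apply: (@within_continuous_paste R _ _ setT id a f g).
- exact: closedT.
- by move=> t; exact: cvg_id.
- exact: continuous_subspaceT.
- exact: continuous_subspaceT.
- by move=> t _ /= ->.
- by move=> t _; rewrite le_eqVlt => /orP[/eqP<-|]; [rewrite lexx|move=> /lt_geF ->].
Qed.

Section clamp.
Context (R : realType).

(** Exit paths are only constrained on the unit interval; precomposition with this
    retraction makes them continuous and monotone on the whole line, the form in
    which paths are lifted below. *)
Definition clamp (t : R) : R := Num.max (Num.min t 1) 0.

Lemma clamp_continuous : continuous clamp.
Proof.
exact: (continuous_compT (@minr_continuous R 1) (@maxr_continuous R 0)).
Qed.

Lemma clamp_itv t : `[0, 1]%classic (clamp t).
Proof.
by rewrite /clamp /= in_itv /= le_max lexx orbT ge_max ge_min lexx orbT ler01.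
Qed.

Lemma clamp_id t : `[0, 1]%classic t -> clamp t = t.
Proof. by rewrite /clamp /= in_itv /= => /andP[? ?]; rewrite min_l // max_l. Qed.

Lemma clamp_le s t : s <= t -> clamp s <= clamp t.
Proof. by move=> st; apply: le_max2 => //; exact: le_min2. Qed.

Lemma clamp_ge1 t : 1 <= t -> clamp t = 1.
Proof. by move=> t1; rewrite /clamp min_r // max_l. Qed.

Lemma clamp_max0 t : clamp (Num.max t 0) = clamp t.
Proof.
rewrite /clamp; have [//|t0] := leP 0 t.
by rewrite (min_l ler01) maxxx max_r // ge_min (ltW t0).
Qed.

Lemma clamp0 : clamp 0 = 0.
Proof. by rewrite clamp_id //= in_itv /= lexx ler01. Qed.

Lemma clamp1 : clamp 1 = 1.
Proof. exact: clamp_ge1. Qed.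

Lemma clamp_within_continuous (X : topologicalType) (f : R -> X) :
  {within `[0, 1]%classic, continuous f} -> continuous (f \o clamp).
Proof.
move=> cf; apply/continuous_subspace_setT.
apply: (@Defs.within_continuous_comp R R X setT _ clamp f _ cf) => [|t _].
  exact/continuous_subspaceT/clamp_continuous.
exact: clamp_itv.
Qed.

End clamp.

Arguments clamp {R} t.

(** * Equality of arrows with varying source *)

(** The two paths start at sources that are only propositionally equal. Their
    homotopy is therefore given as a bare map on the square: this avoids any
    transport of a path along the equality of the sources. *)
Lemma Tagged_exit_homotopy (R : realType) (X : topologicalType) (d : Order.disp_t)
    (P : porderType d) (S : stratification X P) (x1 x2 y : X)
    (f1 : exit_path R S x1 y) (f2 : exit_path R S x2 y) :
    Tagged (fun x => exit_hom R S x y) (exit_class f1)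
      = Tagged (fun x => exit_hom R S x y) (exit_class f2) ->
  exists H : R * R -> X,
    [/\ {within `[0, 1]%classic `*` `[0, 1]%classic, continuous H},
        forall s, `[0, 1]%classic s -> is_exit_path S x1 y (fun t => H (t, s)),
        forall t, `[0, 1]%classic t -> H (t, 0) = f1 t
      & forall t, `[0, 1]%classic t -> H (t, 1) = f2 t].
Proof.
set u1 := Tagged _ _; set u2 := Tagged _ _ => u12.
pose Q (u : {x : X & exit_hom R S x y}) := forall f : exit_path R S (tag u) y,
  exit_class f = tagged u -> exists H : R * R -> X,
    [/\ {within `[0, 1]%classic `*` `[0, 1]%classic, continuous H},
        forall s, `[0, 1]%classic s -> is_exit_path S x1 y (fun t => H (t, s)),
        forall t, `[0, 1]%classic t -> H (t, 0) = f1 t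
      & forall t, `[0, 1]%classic t -> H (t, 1) = f t].
suff : Q u2 by apply.
by rewrite -u12 => f /esym/exit_classP.
Qed.

(** * Tubes around the points of the manifold *)

Section tubes.
Context (R : realType) (n : nat) (M : smooth_manifold R n)
  (gT : finGroupType) (to : {action gT &-> M}).
Hypothesis act_continuous : forall g, continuous (to^~ g).

Lemma actxK g : cancel (to^~ g) (to^~ g^-1%g).
Proof. by move=> x; rewrite -actxM mulgV actx1. Qed.

Lemma actxKV g : cancel (to^~ g^-1%g) (to^~ g).
Proof. by move=> x; rewrite -actxM mulVg actx1. Qed.

Definition saturation (U : set M) : set M := [set y | exists g, U (to y g)].

Lemma open_translate (U : set M) g : open U -> open [set y | U (to y g)].
Proof. by move=> oU; apply: open_comp => // y _; exact: act_continuous. Qed.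

Lemma open_saturation U : open U -> open (saturation U).
Proof.
move=> oU; rewrite (_ : saturation U = \bigcup_g [set y | U (to y g)]).
  by apply: bigcup_open => g _; exact: open_translate.
by apply/seteqP; split=> [y [g ?]|y [g _ ?]]; exists g.
Qed.

(** An open slice at x for the action: the distinct translates are disjoint and
    correspond to the cosets of the stabilizer of x. *)
Record tube (x : M) (U : set M) : Prop := Tube {
  tube_open : open U;
  tube_center : U x;
  tube_stable : forall g y, to x g = x -> U y -> U (to y g);
  tube_separated : forall g y, U y -> U (to y g) -> to x g = x }.

Lemma tube_nbhs x U : tube x U -> nbhs x U.
Proof. by case=> oU Ux _ _; exact: open_nbhs_nbhs. Qed.

Lemma open_forall (I : finType) (U : I -> set M) :
  (forall i, open (U i)) -> open [set y | forall i, U i y].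
Proof.
move=> oU; rewrite openE => y Uy; rewrite /interior /=.
by apply: filter_forall => i; apply: open_nbhs_nbhs.
Qed.

Lemma separating_nbhs x g : to x g <> x ->
  exists W : set M, [/\ open W, W x & forall y, W y -> ~ W (to y g)].
Proof.
move=> /eqP gx; have := @manifold_hausdorff _ _ M.
rewrite open_hausdorff => /(_ _ _ gx)[[A B]] [/= /set_mem Agx /set_mem Bx].
move=> [oA oB /eqP AB]; exists ([set y | A (to y g)] `&` B); split=> //.
  by apply: openI => //; exact: open_translate.
by move=> y [Agy _] [_ Bgy]; have : (A `&` B) (to y g) by []; rewrite AB.
Qed.

(** The points x and x g, when distinct, have disjoint neighbourhoods; since the
    group is finite, x has a neighbourhood V disjoint from its own translates by
    the elements that move x. The intersection of the translates of V by the stabilizer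
    of x is also stable. *)
Lemma tube_basis x N : nbhs x N -> exists2 U, tube x U & U `<=` N.
Proof.
rewrite nbhsE => -[N' [oN' N'x] N'N].
have /choice[W WP] g : exists W : set M, [/\ open W, W x &
    to x g <> x -> forall y, W y -> ~ W (to y g)].
  have [gx|/eqP/separating_nbhs[W [oW Wx WP]]] := eqVneq (to x g) x; last by exists W.
  by exists setT; split=> //; exact: openT.
pose V := N' `&` [set y | forall g, W g y].
have oV : open V.
  by apply: openI => //; apply: open_forall => g; have [] := WP g.
have Vx : V x by split=> // g; have [] := WP g.
exists [set y | forall h, h \in stabilizer to x -> V (to y h)]; last first.
  by move=> y /(_ 1%g); rewrite inE !actx1 eqxx => /(_ isT)[/N'N].
split=> /=.
- apply: open_forall => h; case: (h \in _); last first.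
    by move: (@openT M); congr open; apply/funext => y; apply/propext.
  move: (open_translate h oV); congr open; apply/funext => y.
  by apply/propext; split=> [//|]; exact.
- by move=> h; rewrite inE => /eqP ->.
- move=> g y gx Uy h hx; rewrite -actxM; apply: Uy.
  by move: hx; rewrite !inE actxM gx.
- move=> g y /(_ 1%g) + /(_ 1%g); rewrite inE !actx1 eqxx.
  move=> /(_ isT) [_ Wy] /(_ isT) [_ Wgy]; apply: contrapT => gx.
  by have [_ _ /(_ gx _ (Wy g))] := WP g; apply.
Qed.

Lemma tube_translate x U g :
  tube x U -> tube (to x g) [set y | U (to y g^-1%g)].
Proof.
move=> [oU Ux Ust Usep].
have conj y h : to (to y h) g^-1%g = to (to y g^-1%g) (g * h * g^-1)%g.
  by rewrite -!actxM !mulgA mulVg mul1g.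
split=> /=.
- exact: open_translate.
- by rewrite actxK.
- move=> h y gx Uy; rewrite conj; apply: Ust => //.
  by rewrite !actxM gx actxK.
- move=> h y Uy; rewrite conj => /(Usep _ _ Uy) ghx.
  by rewrite -[in RHS]ghx -!actxM mulgKV.
Qed.

Lemma tube_stabilizer x U y : tube x U -> U y ->
  stabilizer to y \subset stabilizer to x.
Proof.
move=> tU Uy; apply/fintype.subsetP => g; rewrite !inE => /eqP gy.
by apply/eqP/(tube_separated tU Uy); rewrite gy.
Qed.

Lemma isotropy_type_card x y :
    ((isotropy_type to x : (subgroup_class gT)^d) <= isotropy_type to y)%O ->
  (#|stabilizer to y| <= #|stabilizer to x|)%N.
Proof.
rewrite leEdual => /subgroup_class_leP[g sub].
by rewrite -(cardJg _ g); exact: subset_leq_card.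
Qed.

(** Near x the stabilizer can only shrink, and a conjugacy class of subgroups
    that is at least as large rules out a proper subgroup by its cardinality. *)
Lemma tube_stabilizer_eq x U y : tube x U -> U y ->
    ((isotropy_type to y : (subgroup_class gT)^d) <= isotropy_type to x)%O ->
  stabilizer to y = stabilizer to x.
Proof.
move=> tU Uy /isotropy_type_card le; apply/val_inj/eqP.
by rewrite eqEcard (tube_stabilizer tU Uy).
Qed.

(** The saturation of a tube is the disjoint union of the tube and of its other
    translates, all open. *)
Lemma tube_connected x U (f : R -> M) (J : set R) s :
    tube x U -> is_interval J -> continuous f -> J s -> U (f s) ->
    (forall t, J t -> saturation U (f t)) ->
  forall t, J t -> U (f t).
Proof.
move=> tU /connected_intervalP Jconn cf Js Us sat.
(* The closed set V coincides with U on the saturation of U. *)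
pose V : set M := [set y | forall g, to x g <> x -> ~ U (to y g)].
have UV y : saturation U y -> U y <-> V y.
  move=> [g Ugy]; split=> [Uy h hx /(tube_separated tU Uy)//|Vy].
  have gx : to x g = x by apply: contrapT => /Vy.
  rewrite -(actxK g y); apply: (tube_stable tU) => //.
  by rewrite -{1}gx actxK.
have cV : closed V.
  rewrite -[V]setCK; apply: open_closedC.
  rewrite (_ : ~` V = \bigcup_(g in [set g | to x g <> x]) [set y | U (to y g)]).
    by apply: bigcup_open => g _; exact/open_translate/(tube_open tU).
  apply/seteqP; split=> [y /existsNP[g /not_implyP[gx /contrapT ?]]|y [g gx ?] /(_ g gx)//].
  by exists g.
have JE : J `&` f @^-1` U = J.
  apply: Jconn; first by exists s.
    exists (f @^-1` U) => //; apply: open_comp; last exact: tube_open tU.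
    by move=> ? _; exact: cf.
  exists (f @^-1` V); first by apply: preimage_closed => // ? _; exact: cf.
  by apply/seteqP; split=> t [Jt /UV Ut]; split=> //; apply: Ut; exact: sat.
by move=> t; rewrite -JE => -[].
Qed.

(** * Families of paths that converge orbitwise *)

Definition exiting (x : R -> M) : Prop :=
  forall s t, s <= t -> ((isotropy_type to (x s) : (subgroup_class gT)^d)
                        <= isotropy_type to (x t))%O.

(** This is convergence of the projections of h y to that of x as y runs along F,
    jointly in y and in the time. *)
Definition orbitwise_near (Y : Type) (F : set_system Y) (h : Y -> R -> M)
    (x : R -> M) : Prop :=
  forall t N, nbhs (x t) N -> exists2 e : R, 0 < e &
    \forall y \near F, forall s, `|s - t| < e -> saturation N (h y s).

(** Orbitwise convergence confines h y to the saturation of the tube for times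
    near t; convergence at one of these times s selects the tube itself among its
    translates, and connectedness propagates the choice to the others. *)
Lemma lift_near_tube (Y : Type) (F : set_system Y) {FF : Filter F}
    (h : Y -> R -> M) (x : R -> M) t U :
    continuous x -> (forall y, continuous (h y)) -> orbitwise_near F h x ->
    tube (x t) U ->
  exists2 e : R, 0 < e & forall s, `|s - t| < e -> h^~ s @ F --> x s ->
    \forall y \near F, forall r, `|r - t| < e -> U (h y r).
Proof.
move=> cx ch hx tU.
have [e1 e10 satU] := hx _ _ (tube_nbhs tU).
have [e2 e20 xU] := continuous_near cx (tube_nbhs tU).
exists (Num.min e1 e2) => [|s]; first by rewrite lt_min e10.
rewrite lt_min => /andP[s1 s2] /(_ U) hs.
have /hs : nbhs (x s) U.
  by apply: open_nbhs_nbhs; split; [exact: tube_open tU|exact: xU].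
rewrite nbhs_simpl /= => Uhs.
apply: filterS2 satU Uhs => y satU Uhs r.
rewrite lt_min => /andP[r1 _].
apply: (tube_connected (J := [set r | `|r - t| < e1]) (s := s) tU _ (ch y)) => //=.
  move=> u v /= uJ vJ w /andP[uw wv].
  by move: uJ vJ; rewrite !ltr_distl => /andP[? ?] /andP[? ?]; apply/andP; split; lra.
Qed.

(** Pointwise convergence is propagated from time b down to all t. Just before
    a time t where it holds, the limit point x s has the stabilizer of x t, so an
    element moving h y s close to x s, while staying in a tube around x t, fixes
    x s: then h y s is itself close to x s. At a limit of such times, convergence
    at one of them and [lift_near_tube] suffice. The same lemma turns pointwise
    convergence into the locally uniform conclusion. *)
Lemma lift_near (Y : Type) (F : set_system Y) {FF : Filter F}
    (h : Y -> R -> M) (x : R -> M) b :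
    continuous x -> exiting x ->
    (forall y, continuous (h y)) -> orbitwise_near F h x ->
    h^~ b @ F --> x b ->
  forall t, t <= b -> forall N, nbhs (x t) N -> exists2 e : R, 0 < e &
    \forall y \near F, forall s, `|s - t| < e -> N (h y s).
Proof.
move=> cx ex ch hx hb.
have cvg_h t : t <= b -> h^~ t @ F --> x t.
  move: t; apply: downward_real_induction => // t tb IH.
    move=> N /tube_basis[U tU UN].
    have [e e0 He] := lift_near_tube cx ch hx tU.
    pose s := Num.min b (t + e / 2).
    have ts : t < s by rewrite lt_min tb; lra.
    have se : s - t < e.
      by have : s <= t + e / 2; [rewrite ge_min lexx orbT|lra].
    have /He : `|s - t| < e by rewrite ger0_norm; lra.
    have /(IH _ ts) xs : s <= b by rewrite ge_min lexx.
    move=> /(_ xs) Uh; rewrite nbhs_simpl /=; move: Uh; apply: filterS => y /(_ t) Uy.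
    apply/UN/Uy.
    by rewrite subrr normr0.
  have [U tU _] := tube_basis (@filterT _ _ (nbhs_filter (x t))).
  have [e1 e10 He] := lift_near_tube cx ch hx tU.
  have [e2 e20 xU] := continuous_near cx (tube_nbhs tU).
  exists (Num.min e1 e2) => [|s]; first by rewrite lt_min e10.
  move=> ste st; have /andP[st1 st2] : (`|s - t| < e1) && (`|s - t| < e2).
    by rewrite -lt_min ltr0_norm; lra.
  have stabE := tube_stabilizer_eq tU (xU _ st2) (ex _ _ (ltW st)).
  move=> N Nxs; have : nbhs (x s) (N `&` U).
    apply: filterI => //; apply: open_nbhs_nbhs.
    by split; [exact: tube_open tU|exact: xU].
  move=> /tube_basis[V tV VNU].
  have [e3 e30 satV] := hx _ _ (tube_nbhs tV).
  have /He : `|t - t| < e1 by rewrite subrr normr0.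
  move=> /(_ IH) Uh; rewrite nbhs_simpl /=.
  apply: filterS2 satV Uh => y /(_ s) satV /(_ s st1) Uh.
  have [|g Vg] := satV; first by rewrite subrr normr0.
  have gt : to (x t) g = x t by apply: (tube_separated tU Uh); exact: (VNU _ Vg).2.
  have gs : to (x s) g = x s.
    by have /setP/(_ g) := congr1 (@gval _) stabE; rewrite !inE gt eqxx => /eqP.
  apply: (VNU _ _).1; rewrite -(actxK g (h y s)); apply: (tube_stable tV) => //.
  by rewrite -{1}gs actxK.
move=> t tb N /tube_basis[U tU UN].
have [e e0 He] := lift_near_tube cx ch hx tU.
have /He : `|t - t| < e by rewrite subrr normr0.
move=> /(_ (cvg_h _ tb)) Uh; exists e => //.
by apply: filterS Uh => y Uh s /Uh /UN.
Qed.

(** [lift_near] for the family reduced to y: every neighbourhood of x t contains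
    y t. *)
Lemma unique_lift (x y : R -> M) b :
    continuous x -> continuous y -> exiting x ->
    (forall t, orbit_map to (y t) = orbit_map to (x t)) -> x b = y b ->
  forall t, t <= b -> x t = y t.
Proof.
move=> cx cy ex xy xyb t tb.
have FF : Filter (globally [set: unit]) by exact: globally_filter.
have near_h := @lift_near _ _ FF (fun=> y) x b cx ex (fun=> cy).
apply: (@manifold_hausdorff _ _ M) => A B Ax By.
have [||e e0 /= H] := near_h _ _ t tb A Ax.
- move=> s N Nx; have [e e0 xN] := continuous_near cx Nx.
  exists e => //; move=> [] _ r /xN Nxr.
  by have /orbit_mapP[g yg] := xy r; exists g; rewrite yg.
- by rewrite xyb => N Ny [] _; exact: nbhs_singleton Ny.
exists (y t); split; last exact: nbhs_singleton By.
by apply: (H tt) => //; rewrite subrr normr0.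
Qed.

(** * Lifting a path backwards from its end *)

Lemma orbit_map_surj (q : orbit_space to) : exists x, orbit_map to x = q.
Proof.
by exists (repr (q : quotient_topology {eq_quot (orbit_equiv to)})); exact: reprK.
Qed.

Lemma orbit_map_act x g : orbit_map to (to x g) = orbit_map to x.
Proof. by apply/orbit_mapP; exists g^-1%g; rewrite actxK. Qed.

Lemma saturationE U y :
  saturation U y <-> (orbit_map to @` U) (orbit_map to y).
Proof.
split=> [[g Ug]|[z Uz /esym/orbit_mapP[g yg]]].
  by exists (to y g) => //; rewrite orbit_map_act.
by exists g; rewrite yg.
Qed.

Lemma orbit_map_nbhs x U :
  nbhs x U -> nbhs (orbit_map to x) (orbit_map to @` U).
Proof.
rewrite nbhsE => -[V [oV Vx] VU].
apply: (@filterS _ _ _ (orbit_map to @` V)); first exact: image_subset.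
apply: open_nbhs_nbhs; split; last by exists x.
rewrite /open /= /quotient_open.
rewrite (_ : _ @^-1` _ = saturation V); first exact: open_saturation.
by apply/seteqP; split=> y /saturationE.
Qed.

Definition orbit_exiting (q : R -> orbit_space to) : Prop :=
  forall s t, s <= t -> ((orbit_type (q s) : (subgroup_class gT)^d)
                        <= orbit_type (q t))%O.

Lemma exiting_lift (x : R -> M) q : orbit_exiting q ->
  (forall t, orbit_map to (x t) = q t) -> exiting x.
Proof. by move=> eq xq s t st; rewrite -!orbit_typeE !xq; exact: eq. Qed.

(** The points of the tube over q all have the stabilizer of x. Two of them in
    the same orbit differ by an element which, by separation, fixes x, hence fixes
    both: p t is the only point of the tube over q t. Uniqueness makes p
    continuous, since the projection is open. *)
Lemma local_section x U (q : R -> orbit_space to) :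
    tube x U -> continuous q ->
    (forall t, (orbit_map to @` U) (q t)) ->
    (forall t, ((orbit_type (q t) : (subgroup_class gT)^d)
                <= isotropy_type to x)%O) ->
  exists p, [/\ continuous p, forall t, U (p t)
              & forall t, orbit_map to (p t) = q t].
Proof.
move=> tU cq /(_ _)/cid2-/all_sig2[p Up pq] qx.
exists p; split=> // t N Npt; rewrite nbhs_simpl /=.
have stabE z : U z -> (exists s, orbit_map to z = q s) ->
    stabilizer to z = stabilizer to x.
  move=> Uz [s zq]; apply: (tube_stabilizer_eq tU) => //.
  by rewrite -orbit_typeE zq.
have : nbhs (p t) (N `&` U).
  by apply: filterI => //; apply: open_nbhs_nbhs; split; [exact: tube_open tU|].
move=> /orbit_map_nbhs; rewrite pq => /cq; rewrite nbhs_simpl /=.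
apply: filterS => s /= [z [Nz Uz] zs].
suff -> : p s = z by [].
have /orbit_mapP[g zg] : orbit_map to z = orbit_map to (p s) by rewrite zs pq.
have gx : to x g = x by apply: (tube_separated tU Uz); rewrite zg.
have : g \in stabilizer to z by rewrite stabE ?inE ?gx //; exists s.
by rewrite inE zg => /eqP.
Qed.

(** The path to lift is frozen before time a, so that partial lifts are total
    continuous paths and an extension of the lift is a decrease of a. *)
Definition lift_from (q : R -> orbit_space to) b e a (p : R -> M) : Prop :=
  [/\ continuous p, p b = e & forall t, orbit_map to (p t) = q (Num.max t a)].

Lemma lift_from_unique q b e s s' p p' :
    orbit_exiting q -> lift_from q b e s p -> lift_from q b e s' p' -> s <= s' ->
  forall t, s' <= t -> t <= b -> p t = p' t.
Proof.
move=> eq [cp pb pq] [cp' pb' pq'] ss' t st tb.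
have s'b := le_trans st tb.
rewrite -[X in p X](max_l st).
apply: (@unique_lift (p \o Num.max^~ s') p' b _ cp') => //=.
- exact: (continuous_compT (@maxr_continuous R s') cp).
- apply: (@exiting_lift _ (fun t => q (Num.max t s'))) => [u v uv|u].
    by apply: eq; exact: le_max2.
  by rewrite /= pq -maxA (max_l ss').
- by move=> u; rewrite pq' pq -maxA (max_l ss').
- by rewrite max_l // pb pb'.
Qed.

(** By uniqueness the lifts from all s > a assemble into one lift after time a.
    It stays in a tube U around a suitable x over q a, hence, close to a, in any
    smaller tube V around x: its points lie in the saturation of V and in U, and
    elements which relate two points of U fix x and preserve V. So x is its limit
    at a. *)
Lemma lift_from_left_limit q b e a :
    continuous q -> orbit_exiting q -> (forall t, b <= t -> q t = q b) ->
    a < b -> (forall s, a < s -> s <= b -> exists p, lift_from q b e s p) ->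
  exists p, lift_from q b e a p.
Proof.
move=> cq eq qb ab IH.
have /choice[L LP] s : exists p, a < s -> s <= b -> lift_from q b e s p.
  have [s_a|s_a] := leP s a; first by exists (cst e).
  have [sb|sb] := leP s b; last by exists (cst e).
  by have [p ?] := IH _ s_a sb; exists p.
(* The point x is chosen in the orbit q a so that the lift from s, at time s,
   lies in the tube around x rather than in one of its translates. *)
have [x [U [d [s [[d0 xq tU qU] [as_ sb sad Us]]]]]] : exists x U d s,
    [/\ 0 < d, orbit_map to x = q a, tube x U &
      forall t, `|t - a| < d -> (orbit_map to @` U) (q t)] /\
    [/\ a < s, s <= b, s < a + d & U (L s s)].
  have [x xq] := orbit_map_surj (q a).
  have [U tU _] := tube_basis (@filterT _ _ (nbhs_filter x)).
  have := orbit_map_nbhs (tube_nbhs tU); rewrite xq => /(continuous_near cq).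
  move=> [d d0 qU]; pose s := Num.min b (a + d / 2).
  have as_ : a < s by rewrite lt_min ab; lra.
  have sb : s <= b by rewrite ge_min lexx.
  have sad : s < a + d.
    by have : s <= a + d / 2; [rewrite ge_min lexx orbT|lra].
  have [_ _ Lq] := LP _ as_ sb.
  have : saturation U (L s s).
    by apply/saturationE; rewrite Lq maxxx; apply: qU; rewrite ger0_norm; lra.
  move=> [g Ug]; exists (to x g^-1%g), [set y | U (to y g)], d, s; split=> //.
  split=> //; first by rewrite orbit_map_act.
    by have := tube_translate g^-1 tU; rewrite invgK.
  move=> t /qU[y Uy yq]; exists (to y g^-1%g); last by rewrite orbit_map_act.
  by rewrite /= actxKV.
(* The argument is clamped to b because L s is a lift only when s <= b. *)
pose p t := if t <= a then x else L (Num.min t b) (Num.min t b).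
have pL r t : a < r -> r <= b -> r <= t -> p t = L r (Num.min t b).
  move=> ar rb rt; rewrite /p (lt_geF (lt_le_trans ar rt)).
  have am : a < Num.min t b by rewrite lt_min ab (lt_le_trans ar rt).
  have mb : Num.min t b <= b by rewrite ge_min lexx orbT.
  apply/esym/(lift_from_unique eq (LP _ ar rb) (LP _ am mb)) => //.
  by rewrite le_min rt.
have pq t : a < t -> orbit_map to (p t) = q t.
  move=> at_; rewrite /p (lt_geF at_).
  have am : a < Num.min t b by rewrite lt_min ab at_.
  have mb : Num.min t b <= b by rewrite ge_min lexx orbT.
  have [_ _ ->] := LP _ am mb; rewrite maxxx.
  by case: (leP t b) => // /ltW /qb.
have ULs t : a < t -> t < a + d -> U (p t).
  move=> at_ td; pose r := Num.min s t.
  have ar : a < r by rewrite lt_min as_.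
  have rs : r <= s by rewrite ge_min lexx.
  have rt : r <= t by rewrite ge_min lexx orbT.
  have rb := le_trans rs sb.
  have [cL _ Lq] := LP _ ar rb.
  rewrite (pL r) //.
  (* The interval contains t and also s, at which p is in U by the choice of x. *)
  apply: (tube_connected (J := [set u | r <= u < a + d]) (s := s) tU _
    (continuous_compT (@minr_continuous R b) cL)) => /=.
  - move=> u v /= /andP[ru _] /andP[_ vd] w /andP[uw wv].
    by rewrite (le_trans ru uw) (le_lt_trans wv vd).
  - by rewrite rs.
  - by rewrite -pL // (pL s) // min_l.
  - move=> u /andP[ru ud]; apply/saturationE; rewrite /= -pL // pq.
      by apply: qU; rewrite ger0_norm; lra.
    exact: lt_le_trans ru.
  - by rewrite rt.
exists p; split; first last.
- move=> t; case: (leP t a) => ta; first by rewrite /p ta.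
  exact: pq.
- by rewrite /p (lt_geF ab) minxx; have [] := LP b ab (lexx b).
move=> t N Npt; rewrite nbhs_simpl /=.
have [ta|ta|ta] := ltgtP t a.
- apply: filterS (lt_nbhsl ta) => u /ltW ua /=.
  by move: (nbhs_singleton Npt); rewrite /p (ltW ta) ua.
- pose r := Num.min b ((a + t) / 2).
  have ar : a < r by rewrite lt_min ab; lra.
  have rb : r <= b by rewrite ge_min lexx.
  have rt : r < t by rewrite gt_min; apply/orP; right; lra.
  have [cL _ _] := LP _ ar rb.
  move: Npt; rewrite (pL _ _ ar rb (ltW rt)).
  move=> /(continuous_compT (@minr_continuous R b) cL); rewrite nbhs_simpl /=.
  apply: filterS2 (lt_nbhsr rt) => u ru /=; rewrite -pL //.
  exact: ltW.
- rewrite {}ta in Npt *; have : nbhs x (N `&` U).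
    by apply: filterI (tube_nbhs tU); move: Npt; rewrite /p lexx.
  move=> /tube_basis[V tV VNU].
  have := orbit_map_nbhs (tube_nbhs tV); rewrite xq => /(continuous_near cq).
  move=> [d' d'0 qV]; apply/nbhs_ballP; exists (Num.min d d') => /=.
    by rewrite lt_min d0.
  move=> u; rewrite /ball /= distrC lt_min => /andP[ud ud'].
  have [ua|au] := leP u a; first by rewrite /p ua; exact: (VNU _ (tube_center tV)).1.
  have Uu : U (p u) by apply: ULs => //; move: ud; rewrite ltr_distl => /andP[_]; lra.
  have /saturationE[g Vg] : (orbit_map to @` V) (orbit_map to (p u)).
    by rewrite pq //; exact: qV.
  have gx : to x g = x by apply: (tube_separated tU Uu); exact: (VNU _ Vg).2.
  apply: (VNU _ _).1; rewrite -(actxK g (p u)); apply: (tube_stable tV) => //.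
  by rewrite -{1}gx actxK.
Qed.

(** A lift from a extends to the left of a by [local_section] for a tube around
    its value at a. *)
Lemma exists_lift (q : R -> orbit_space to) b e :
    continuous q -> orbit_exiting q ->
    (forall t, b <= t -> q t = q b) -> orbit_map to e = q b ->
  forall a, a <= b -> exists p, lift_from q b e a p.
Proof.
move=> cq eq qb eqb.
have cqmax a : continuous (fun t => q (Num.max t a)).
  exact: (continuous_compT (@maxr_continuous R a) cq).
have eqmax a : orbit_exiting (fun t => q (Num.max t a)).
  by move=> s t st; apply: eq; exact: le_max2.
apply: downward_real_induction.
- exists (cst e); split=> // [t|t]; first exact: cvg_cst.
  by rewrite /= qb // le_max lexx orbT.
- move=> a ab IH; exact: lift_from_left_limit.
move=> a ab [p [cp pb pq]].
have [U tU _] := tube_basis (@filterT _ _ (nbhs_filter (p a))).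
have pa : orbit_map to (p a) = q a by rewrite pq maxxx.
have := orbit_map_nbhs (tube_nbhs tU); rewrite pa => /(continuous_near cq).
move=> [d d0 qU]; exists d => // s ads sa.
have clampE t : s <= Num.max s (Num.min t a) <= a.
  by rewrite le_max lexx ge_max (ltW sa) ge_min lexx orbT.
(* The time is clamped to [s, a], on which q stays over the tube and, by
   monotonicity, below the isotropy type of p a. *)
have [|t|t|r [cr Ur rq]] :=
  @local_section _ _ (fun t => q (Num.max (Num.min t a) s)) tU.
- exact: (continuous_compT (@minr_continuous R a) (cqmax s)).
- apply: qU; rewrite maxC; have /andP[? ?] := clampE t.
  by rewrite ler0_norm; lra.
- rewrite -orbit_typeE pa; apply: eq; rewrite maxC.
  by have /andP[] := clampE t.
have ra : r a = p a.
  have /esym/orbit_mapP[g pg] : orbit_map to (r a) = orbit_map to (p a).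
    by rewrite rq pa minxx max_l // ltW.
  rewrite -pg; apply: (tube_separated tU (tube_center tU)).
  by rewrite pg.
exists (fun t => if t <= a then r t else p t); split.
- exact: continuous_paste.
- case: (leP b a) => // ba; have ba' : b = a by apply/eqP; rewrite eq_le ba.
  by rewrite -pb ba'.
- move=> t; case: (leP t a) => ta; first by rewrite rq min_l.
  by rewrite pq; congr q; rewrite !max_l // ltW // (lt_trans sa).
Qed.

End tubes.

(** * Lifting exit paths and exit homotopies *)

Section lifting.
Context (R : realType) (n : nat) (M : smooth_manifold R n)
  (gT : finGroupType) (to : {action gT &-> M}).
Hypothesis smooth_to : smooth_action to.

Local Notation S := (isotropy_stratification smooth_to).
Local Notation T := (orbit_stratification smooth_to).
Local Notation push := (map_exit (S := S) (T := T)
  (@orbit_map_continuous _ _ _ _ to) (orbit_typeE to)).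
Local Notation I01 := (`[0, 1]%classic).

Lemma smooth_action_continuous g : continuous (to^~ g).
Proof. exact: (smooth_to g).1. Qed.

Let act_continuous := smooth_action_continuous.

Lemma exit_path_exiting b q (f : R -> orbit_space to) :
  is_exit_path T b q f -> orbit_exiting (f \o clamp).
Proof.
move=> [_ mf _ _] s t st; apply: mf; last 1 first.
- by have := clamp_itv t; rewrite /= in_itv /= => /andP[].
- by have := clamp_itv s; rewrite /= in_itv /= => /andP[].
- exact: clamp_le.
Qed.

Lemma exit_path_lift b e (f : R -> orbit_space to) :
    is_exit_path T b (orbit_map to e) f ->
  exists x : R -> M, [/\ continuous x, x 1 = e
    & forall t, orbit_map to (x t) = f (clamp t)].
Proof.
move=> ef; have [cf _ _ f1] := ef.
have [|t t1||x [cx x1 xf]] := @exists_lift _ _ _ _ _ act_continuous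
  (f \o clamp) 1 e _ (exit_path_exiting ef) _ _ 0 ler01.
- exact: clamp_within_continuous.
- by rewrite /= !clamp_ge1.
- by rewrite /= clamp1.
by exists x; split=> // t; rewrite xf /= clamp_max0.
Qed.

Lemma lift_is_exit_path b q (f : R -> orbit_space to) (x : R -> M) :
    is_exit_path T b q f -> continuous x ->
    (forall t, orbit_map to (x t) = f (clamp t)) ->
  is_exit_path S (x 0) (x 1) x.
Proof.
move=> /exit_path_exiting ef cx xf; split=> //.
  exact: continuous_subspaceT.
by move=> s t _ st _; exact: (exiting_lift ef).
Qed.

Lemma clamped_exit_path x y (f : R -> M) : is_exit_path S x y f ->
  [/\ continuous (f \o clamp), exiting to (f \o clamp),
      f (clamp 0) = x & f (clamp 1) = y].
Proof.
move=> [cf mf f0 f1]; split; rewrite ?clamp0 ?clamp1 //.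
  exact: clamp_within_continuous.
move=> s t st; apply: mf; last 1 first.
- by have := clamp_itv t; rewrite /= in_itv /= => /andP[].
- by have := clamp_itv s; rewrite /= in_itv /= => /andP[].
- exact: clamp_le.
Qed.

(** Each slice is lifted separately with end e; these choices depend
    continuously on the homotopy parameter by [lift_near], whose assumption at the
    final time holds because all the lifts end at e. *)
Lemma homotopy_lift b e (K : R * R -> orbit_space to) :
    {within I01 `*` I01, continuous K} ->
    (forall s, I01 s -> is_exit_path T b (orbit_map to e) (fun t => K (t, s))) ->
  exists H : R * R -> M,
    [/\ {within I01 `*` I01, continuous H},
        forall s, continuous (fun t => H (t, s)),
        forall s, H (1, s) = e
      & forall t s, orbit_map to (H (t, s)) = K (clamp t, clamp s)].
Proof.
move=> cK eK.
have /choice[h hP] s := exit_path_lift (eK _ (clamp_itv s)).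
have ch s : continuous (h s) by have [] := hP s.
have h1 s : h s 1 = e by have [] := hP s.
have hK s t : orbit_map to (h s t) = K (clamp t, clamp s) by have [_ _ ->] := hP s.
exists (fun z => h z.2 z.1); split=> //.
have cKc : continuous (fun z : R * R => K (clamp z.1, clamp z.2)).
  apply/continuous_subspace_setT; apply: (Defs.within_continuous_comp _ cK).
    apply/continuous_subspaceT/pair_continuous => z.
      exact: (continuous_comp (@cvg_fst _ _ _ _ _) (@clamp_continuous R _)).
    exact: (continuous_comp (@cvg_snd _ _ _ _ _) (@clamp_continuous R _)).
  by move=> z _; split; exact: clamp_itv.
apply/subspace_continuousP => -[t s] /= [tI sI] N hN.
have t1 : t <= 1 by move: tI; rewrite in_itv /= => /andP[].
have eh : exiting to (h s).
  exact: (exiting_lift (exit_path_exiting (eK _ (clamp_itv s))) (hK s)).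
have nh : orbitwise_near to (nbhs s) h (h s).
  move=> v V /(orbit_map_nbhs act_continuous); rewrite hK.
  move=> /(cKc (v, s))[[A B] /= [At Bs] AB].
  have [d d0 dA] := nbhs_realP At; exists d => //.
  apply: filterS Bs => r Br u /dA Au; apply/saturationE.
  by rewrite hK; exact: (AB (u, r)).
have cvg1 : h^~ 1 @ nbhs s --> h s 1.
  rewrite (_ : h^~ 1 = cst e); last by apply/funext => r; exact: h1.
  by rewrite h1; exact: cvg_cst.
have [d d0 near_h] := lift_near act_continuous (ch s) eh ch nh cvg1 t1 hN.
rewrite nbhs_simpl /= /within /=.
exists (ball t d, [set r | forall u, `|u - t| < d -> N (h r u)]).
  by split=> //=; exact: nbhsx_ballx.
move=> [u r] /= [ut Nr] _; apply: Nr; rewrite distrC; exact: ut.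
Qed.

Lemma quotient_lift b e (f : exit_path R T b (orbit_map to e)) :
  exists e' (x : exit_path R S e' e),
    Tagged (fun b' => exit_hom R T b' (orbit_map to e))
      (push (exit_class x))
    = Tagged (fun b' => exit_hom R T b' (orbit_map to e)) (exit_class f).
Proof.
have fP := path_funP f; have [x [cx x1 xf]] := exit_path_lift fP.
have xP := lift_is_exit_path fP cx xf; rewrite x1 in xP.
have x0 : orbit_map to (x 0) = b by rewrite xf clamp0; have [_ _ ->] := fP.
exists (x 0), (ExitPath xP); rewrite map_exitE.
case: _ / x0 in f fP xf *; congr Tagged.
apply/exit_classP/exit_homotopic_eq => t tI /=.
by rewrite xf clamp_id.
Qed.

(** A homotopy K between the projections lifts to a homotopy H that ends at e. By
    uniqueness of lifts of paths, the extreme slices of H are the two given paths,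
    and the path of the starting points of H, which lifts a constant path, is
    constant. *)
Lemma quotient_lift_unique e e1 e2
    (f1 : exit_path R S e1 e) (f2 : exit_path R S e2 e) :
    Tagged (fun b' => exit_hom R T b' (orbit_map to e))
      (push (exit_class f1))
    = Tagged (fun b' => exit_hom R T b' (orbit_map to e))
      (push (exit_class f2)) ->
  Tagged (fun x => exit_hom R S x e) (exit_class f1)
  = Tagged (fun x => exit_hom R S x e) (exit_class f2).
Proof.
rewrite !map_exitE => /Tagged_exit_homotopy[K [cK eK K1 K2]].
have [H [cH cHt H1 HK]] := homotopy_lift cK eK.
have He s t : I01 s -> I01 t -> orbit_map to (H (t, s)) = K (t, s).
  by move=> ? ?; rewrite HK !clamp_id.
have I0 : I01 (0 : R) by rewrite /= in_itv /= lexx ler01.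
have I1 : I01 (1 : R) by rewrite /= in_itv /= lexx ler01.
have Hexit s : is_exit_path S (H (0, s)) e (fun t => H (t, s)).
  rewrite -[X in is_exit_path _ _ X](H1 s).
  exact: (lift_is_exit_path (eK _ (clamp_itv s)) (cHt s) (HK^~ s)).
have HE e' (f : exit_path R S e' e) s : I01 s ->
    (forall t, I01 t -> K (t, s) = orbit_map to (f t)) ->
    forall t, I01 t -> H (t, s) = f t.
  move=> sI Kf t tI; have [cf ef _ f1'] := clamped_exit_path (path_funP f).
  rewrite -[in RHS](clamp_id tI).
  apply/esym/(unique_lift act_continuous cf (cHt s) ef (b := 1)).
  - by move=> r; rewrite HK (clamp_id sI) Kf //; exact: clamp_itv.
  - by rewrite H1.
  - by move: tI; rewrite /= in_itv /= => /andP[].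
have HE1 := HE _ f1 0 I0 K1; have HE2 := HE _ f2 1 I1 K2.
have H0cst s : I01 s -> H (0, s) = H (0, 1).
  move=> sI; rewrite -[in LHS](clamp_id sI).
  have cH0 : continuous (fun r => H (0, clamp r)).
    apply: (@clamp_within_continuous R M (fun r => H (0, r))).
    apply: (Defs.within_continuous_comp (f := fun r => (0, r)) _ cH) => //.
    apply/continuous_subspaceT/pair_continuous => r; first exact: cvg_cst.
    exact: cvg_id.
  apply/esym/(unique_lift act_continuous (x := cst (H (0, 1)))
    (y := fun r => H (0, clamp r)) (b := 1)) => //=.
  - by move=> r; exact: cvg_cst.
  - move=> r; rewrite !He //; last exact: clamp_itv.
    by have [_ _ -> _] := eK _ (clamp_itv r); have [_ _ -> _] := eK _ I1.
  - by rewrite clamp1.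
  - by move: sI; rewrite /= in_itv /= => /andP[].
have e12 : e1 = e2.
  have [_ _ f10 _] := path_funP f1; have [_ _ f20 _] := path_funP f2.
  by rewrite -[LHS]f10 -[RHS]f20 -(HE1 _ I0) -(HE2 _ I0) H0cst.
case: _ / e12 in f2 K2 HE2 *; congr Tagged; apply/exit_classP; exists H; split=> //.
move=> s sI; have [_ _ f20 _] := path_funP f2.
rewrite (_ : e1 = H (0, s)); first exact: Hexit.
by rewrite -[LHS]f20 -(HE2 _ I0) (H0cst _ sI).
Qed.

End lifting.

Theorem lemma0p0p3 (R : realType) (n : nat) (M : smooth_manifold R n)
    (gT : finGroupType) (to : {action gT &-> M}) (smooth_to : smooth_action to) :
  right_fibration (quotient_functor smooth_to).
Proof.
move=> e b f; rewrite -(exit_reprK f).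
have [e' [x xf]] := quotient_lift (exit_repr f).
exists (Tagged (fun a => exit_hom R (isotropy_stratification smooth_to) a e)
  (exit_class x)).
split=> // -[e2 f2]; rewrite -xf -(exit_reprK f2) => /= H.
exact/esym/quotient_lift_unique.
Qed.
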